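(* Let $L\subset\mathbb{Z}^n$ be a lattice. Any strictly descending chain (with respect to $\leq_{I_L}$) of equivalence classes of $I_L$-fibers is finite.
   Context: Let $\mathbb{N}=\mathbb{Z}_{\ge0}$. A lattice is a subgroup $L\subset\mathbb{Z}^n$. An $I_L$-fiber is a set of monomials in $x_1,\ldots,x_n$ of the form $F_u=\{x^v:v\in\mathbb{N}^n,\ v-u\in L\}$ with $u\in\mathbb{N}^n$. Fibers $F,G$ are equivalent if there are $u,v\in\mathbb{N}^n$ with $x^uF\subset G$ and $x^vG\subset F$; $\overline F$ denotes the equivalence class of $F$. Write $\overline F\le_{I_L}\overline G$ if there is $u\in\mathbb{N}^n$ with $x^uF\subset G$; this is a well-defined partial order on equivalence classes of $I_L$-fibers. *)

(* Defs.v *)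
From HB Require Import structures.
From mathcomp Require Import all_boot all_order all_algebra.
From mathcomp Require Import boolp classical_sets.
From mathcomp Require Import mpoly.

Set Implicit Arguments.
Unset Strict Implicit.
Unset Printing Implicit Defensive.

Import Order.TTheory GRing.Theory.
Local Open Scope ring_scope.
Local Open Scope quotient_scope.
Local Open Scope classical_set_scope.

(* ['X_{1..n}] is multinomials' type of monomials in n variables: x^v is
   identified with v, and (u + v)%MM is the product x^u x^v.  *)

(* v - u, as a vector of Z^n *)
Definition mnm_diff (n : nat) (v u : 'X_{1..n}) : 'rV[int]_n :=
  \row_i ((v i)%:Z - (u i)%:Z).

Definition mnm_mul_set (n : nat) (u : 'X_{1..n}) (F : set 'X_{1..n}) :
  set 'X_{1..n} := [set (u + v)%MM | v in F].

Definition fiber_of (n : nat) (L : zmodClosed 'rV[int]_n) (u : 'X_{1..n}) :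
  set 'X_{1..n} := [set v | mnm_diff v u \in L].

Record fiber (n : nat) (L : zmodClosed 'rV[int]_n) := Fiber {
  fiber_set :> set 'X_{1..n};
  fiberP : exists u, fiber_set = fiber_of L u
}.

HB.instance Definition _ (n : nat) (L : zmodClosed 'rV[int]_n) :=
  gen_eqMixin (fiber L).
HB.instance Definition _ (n : nat) (L : zmodClosed 'rV[int]_n) :=
  gen_choiceMixin (fiber L).

Section FiberClass.
Variables (n : nat) (L : zmodClosed 'rV[int]_n).
Implicit Types F G H : fiber L.

Definition fiber_le F G : Prop := exists u, mnm_mul_set u F `<=` G.

Definition fiber_equiv F G : Prop :=
  exists u v, mnm_mul_set u F `<=` G /\ mnm_mul_set v G `<=` F.

Lemma fiber_le_refl F : fiber_le F F.
Proof. by exists 0%MM => _ [v Fv <-]; rewrite add0m. Qed.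

Lemma fiber_le_trans F G H : fiber_le F G -> fiber_le G H -> fiber_le F H.
Proof.
move=> [u FG] [w GH]; exists (w + u)%MM => _ [v Fv <-].
by rewrite -addmA; apply: GH; exists (u + v)%MM => //; apply: FG; exists v.
Qed.

Lemma fiber_equivE F G : fiber_equiv F G <-> fiber_le F G /\ fiber_le G F.
Proof.
split=> [[u [v [uFG vGF]]]|[[u uFG] [v vGF]]]; last by exists u, v.
by split; [exists u | exists v].
Qed.

Definition fiber_equivb : rel (fiber L) := fun F G => `[< fiber_equiv F G >].

Lemma fiber_equivb_refl : reflexive fiber_equivb.
Proof.
by move=> F; apply/asboolP/fiber_equivE; split; apply: fiber_le_refl.
Qed.

Lemma fiber_equivb_sym : ssrbool.symmetric fiber_equivb.
Proof.
by move=> F G; apply: asbool_equiv_eq; split=> /fiber_equivE [? ?];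
  apply/fiber_equivE.
Qed.

Lemma fiber_equivb_trans : transitive fiber_equivb.
Proof.
move=> G F H /asboolP/fiber_equivE [FG GF] /asboolP/fiber_equivE [GH HG].
by apply/asboolP/fiber_equivE; split;
  [apply: fiber_le_trans FG GH | apply: fiber_le_trans HG GF].
Qed.

Canonical fiber_equiv_rel :=
  EquivRel fiber_equivb fiber_equivb_refl fiber_equivb_sym fiber_equivb_trans.

Definition fiber_class := {eq_quot fiber_equiv_rel}.

HB.instance Definition _ := Choice.on fiber_class.
HB.instance Definition _ := EqQuotient.on fiber_class.

(* By [fiber_class_le_pi] this does not depend on the representatives.  *)
Definition fiber_class_le : rel fiber_class :=
  fun C D => `[< fiber_le (repr C) (repr D) >].

Lemma pi_fiber_classP F G :
  \pi_fiber_class F = \pi_fiber_class G <-> fiber_equiv F G.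
Proof.
split=> [/eqP|FG]; first by rewrite eqmodE => /asboolP.
by apply/eqP; rewrite eqmodE; apply/asboolP.
Qed.

Lemma fiber_class_le_pi F G :
  fiber_class_le (\pi_fiber_class F) (\pi_fiber_class G) <-> fiber_le F G.
Proof.
have E (H : fiber L) : fiber_equiv (repr (\pi_fiber_class H)) H.
  by apply/pi_fiber_classP; rewrite reprK.
have [/fiber_equivE [rF Fr] /fiber_equivE [rG Gr]] := (E F, E G).
rewrite /fiber_class_le asboolE; split=> [le_r|le_FG].
  exact: fiber_le_trans (fiber_le_trans Fr le_r) rG.
exact: fiber_le_trans (fiber_le_trans rF le_FG) Gr.
Qed.

Lemma fiber_class_le_refl : reflexive fiber_class_le.
Proof. by move=> C; apply/asboolP/fiber_le_refl. Qed.

Lemma fiber_class_le_anti : antisymmetric fiber_class_le.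
Proof.
move=> C D /andP [/asboolP CD /asboolP DC].
by rewrite -[C]reprK -[D]reprK; apply/pi_fiber_classP/fiber_equivE.
Qed.

Lemma fiber_class_le_trans : transitive fiber_class_le.
Proof.
by move=> D C E /asboolP CD /asboolP DE; apply/asboolP/(fiber_le_trans CD DE).
Qed.

Fact fiber_class_display : Order.disp_t. Proof. exact: Order.Disp tt tt. Qed.

HB.instance Definition _ := Order.Le_isPOrder.Build fiber_class_display
  fiber_class fiber_class_le_refl fiber_class_le_anti fiber_class_le_trans.

End FiberClass.

(* Main.v *)
Require Import Defs.
From HB Require Import structures.
From mathcomp Require Import all_boot all_order all_algebra.
From mathcomp Require Import boolp classical_sets.
From mathcomp Require Import mpoly.
From mathcomp Require Import ring.

Import Order.TTheory GRing.Theory.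

(** The order on classes is coarser than divisibility of monomials: as soon as
    some element [a] of a fiber [F] divides some element [b] of a fiber [G],
    multiplication by the single monomial [b - a] carries all of [F] into [G],
    because both fibers consist of the nonnegative vectors of cosets of the same
    lattice ([fiber_le_of_lepm]).

    Given a sequence of classes, choose one monomial in a representative of each.
    By Dickson's lemma ([dickson]) some earlier monomial divides a later one, so
    the earlier class lies below the later one.  A strictly descending sequence
    would put the later class strictly below the earlier one, which is absurd.

    Dickson's lemma comes from extracting a nondecreasing subsequence of
    exponents one variable at a time ([nondecreasing_subsequences]). *)

(** Each term of the subsequence is an index at which the minimum of [f] over
    all the indices beyond the previous term is attained; every later term
    belongs to that tail, so its value cannot be smaller. *)
Lemma nondecreasing_subsequence (f : nat -> nat) :
  exists phi : nat -> nat,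
    {homo phi : i j / (i < j)%N} /\ {homo f \o phi : i j / (i <= j)%N}.
Proof.
have tail_min N : exists m, (N <= m)%N /\ forall k, (N <= k)%N -> (f m <= f k)%N.
  have exV : exists v, `[< exists2 m, (N <= m)%N & f m = v >].
    by exists (f N); apply/asboolP; exists N.
  case: (ex_minnP exV) => v /asboolP[m leNm <-] min_v.
  by exists m; split=> // k leNk; apply: min_v; apply/asboolP; exists k.
have [g g_min] := choice tail_min.
have g_ge N : (N <= g N)%N by have [] := g_min N.
have g_le N k : (N <= k)%N -> (f (g N) <= f k)%N by have [_] := g_min N; apply.
pose phi k := g (iter k (fun N => (g N).+1) 0%N).
exists phi; split.
  by apply: homo_ltn => [y x z|k]; [apply: ltn_trans | apply: g_ge].
apply: homo_leq => [x|y x z|k] //=; first exact: leq_trans.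
by apply: g_le; apply: leq_trans (g_ge _) (ltnW (g_ge _)).
Qed.

(** Passing to a further subsequence keeps the sequences already treated
    nondecreasing, so finitely many sequences can be treated in turn. *)
Lemma nondecreasing_subsequences (I : eqType) (s : seq I) (f : I -> nat -> nat) :
  exists phi : nat -> nat, {homo phi : i j / (i < j)%N} /\
    forall x, x \in s -> {homo f x \o phi : i j / (i <= j)%N}.
Proof.
elim: s => [|y s [phi [phi_lt phi_s]]]; first by exists id; split.
have [psi [psi_lt psi_y]] := nondecreasing_subsequence (f y \o phi).
exists (phi \o psi); split=> [i j lt_ij|x]; first exact/phi_lt/psi_lt.
rewrite inE => /predU1P[-> //|/phi_s f_le] i j le_ij.
by apply: f_le; apply: (ltnW_homo psi_lt).
Qed.

Lemma dickson (n : nat) (a : nat -> 'X_{1..n}) :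
  exists i j, (i < j)%N /\ (a i <= a j)%MM.
Proof.
have [phi [phi_lt phi_a]] :=
  nondecreasing_subsequences _ (enum 'I_n) (fun x k => a k x).
exists (phi 0%N), (phi 1%N); split; first exact: phi_lt.
by apply/mnm_lepP => x; apply: (phi_a x) => //; rewrite mem_enum.
Qed.

(** The monomial [u = b - a] satisfies [(u + v) - b = v - a] for every [v]; this
    lies in [L] when [a] and [v] are in the same fiber, so [u + v] is in the
    fiber of [b]. *)
Lemma fiber_le_of_lepm {n : nat} {L : zmodClosed 'rV[int]_n} {F G : fiber L}
    {a b : 'X_{1..n}} :
  fiber_set F a -> fiber_set G b -> (a <= b)%MM -> fiber_le F G.
Proof.
have [[w Fw] [w' Gw']] := (fiberP F, fiberP G); rewrite Fw Gw' => /= Fa Gb le_ab.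
exists (b - a)%MM => _ [v Fv <-]; move: Fv; rewrite Fw Gw' /fiber_of /= => Fv.
have -> : mnm_diff (b - a + v)%MM w'
    = (mnm_diff b w' + (mnm_diff v w - mnm_diff a w))%R.
  apply/rowP => i; rewrite !mxE mnmDE -[in RHS](submK le_ab) mnmDE !PoszD.
  ring.
by rewrite rpredD ?rpredB.
Qed.

Theorem theorem3p8 (n : nat) (L : zmodClosed 'rV[int]_n) :
  ~ (exists C : nat -> fiber_class L, forall k : nat, (C k.+1 < C k)%O).
Proof.
case=> C C_desc.
have C_lt : {homo C : i j / (i < j)%N >-> (j < i)%O}.
  by apply: homo_ltn => // D E G lt_DE lt_GD; apply: lt_trans lt_GD lt_DE.
have exa k : exists a, fiber_set (repr (C k)) a.
  have [a ->] := fiberP (repr (C k)); exists a; rewrite /fiber_of /=.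
  suff -> : mnm_diff a a = 0%R by apply: rpred0.
  by apply/rowP => i; rewrite !mxE subrr.
have [a aC] := choice exa.
have [i [j [lt_ij le_a]]] := dickson _ a.
have /asboolP le_C := fiber_le_of_lepm (aC i) (aC j) le_a.
by have := lt_le_trans (C_lt _ _ lt_ij) le_C; rewrite ltxx.
Qed.
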